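(* Let $m \ge 1$, $r \ge 1$, and $k_1,\dots,k_m$ be integers with $2r < k_i$ for all $i$, and let $L(T_{k_1,\dots,k_m}^r)$ be the Laplacian matrix of the $m$-dimensional $r$-nearest neighbor torus $T_{k_1,\dots,k_m}^r$. Then the eigenvalues of $L(T_{k_1,\dots,k_m}^r)$, listed with multiplicity, are $$\lambda_{j_1,\dots,j_m}\left(L(T_{k_1,\dots,k_m}^r)\right) = (2r+1)m - \sum_{i=1}^m \frac{\sin\frac{(2r+1)\pi j_i}{k_i}}{\sin\frac{\pi j_i}{k_i}},$$ for $j_i = 0,1,\dots,k_i-1$ ($i=1,\dots,m$), where for $j_i=0$ the corresponding quotient is read as its limiting value $2r+1$.
   Context: The $r$-nearest neighbor cycle $C_k^r$ (with $2r<k$) is the simple undirected graph on the vertex set $\mathbb{Z}/k\mathbb{Z}$ in which two distinct vertices are adjacent iff they differ by one of $\pm 1, \dots, \pm r$ modulo $k$. The $m$-dimensional $r$-nearest neighbor torus $T_{k_1,\dots,k_m}^r$ is the Cartesian (box) product of the graphs $C_{k_1}^r, \dots, C_{k_m}^r$. The Laplacian matrix of a graph is $L = D - A$, where $A$ is the adjacency matrix and $D$ the diagonal matrix of vertex degrees. *)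

(* Defs.v *)
From mathcomp Require Import all_boot all_order all_algebra.
From mathcomp Require Import reals trigo.

Set Implicit Arguments.
Unset Strict Implicit.
Unset Printing Implicit Defensive.
Import Order.TTheory GRing.Theory Num.Theory.

Local Open Scope ring_scope.

Record sgraph (V : finType) := SGraph {
  adj :> rel V;
  adj_sym : symmetric adj;
  adj_irr : irreflexive adj }.

Definition degree (V : finType) (G : sgraph V) (u : V) : nat :=
  #|[set v | G u v]|.

(* Matrices are indexed by 'I_#|V|; the index i stands for the vertex
   enum_val i. *)
Definition adjacency_mx (R : pzRingType) (V : finType) (G : sgraph V) :
  'M[R]_#|V| := \matrix_(i, j) (G (enum_val i) (enum_val j))%:R.

Definition degree_mx (R : pzRingType) (V : finType) (G : sgraph V) :
  'M[R]_#|V| := diag_mx (\row_i (degree G (enum_val i))%:R).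

Definition laplacian (R : pzRingType) (V : finType) (G : sgraph V) :
  'M[R]_#|V| := degree_mx R G - adjacency_mx R G.

Section BoxProduct.
Variables (I : finType) (V : I -> finType) (G : forall i, sgraph (V i)).

Definition box_adj : rel {dffun forall i, V i} := fun u v =>
  [exists i, G i (u i) (v i) && [forall j, (j != i) ==> (u j == v j)]].

Lemma box_adj_sym : symmetric box_adj.
Proof.
move=> u v; apply: eq_existsb => i; rewrite adj_sym; congr (_ && _).
by apply: eq_forallb => j; rewrite [u j == _]eq_sym.
Qed.

Lemma box_adj_irr : irreflexive box_adj.
Proof.
move=> u; apply/negbTE; rewrite /box_adj negb_exists; apply/forallP => i.
by rewrite adj_irr.
Qed.

Definition box_product := SGraph box_adj_sym box_adj_irr.
End BoxProduct.

(* 'Z_k is Z/kZ only when 1 < k; this follows from 2 * r < k and 1 <= r. *)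
Section NearestNeighborCycle.
Variables (r k : nat).

Definition nn_cycle_adj : rel 'Z_k := fun u v =>
  (u != v) &&
  [exists s : 'I_r.+1,
    (0 < s)%N && ((v - u == (s : nat)%:R) || (v - u == - (s : nat)%:R))].

Lemma nn_cycle_adj_sym : symmetric nn_cycle_adj.
Proof.
move=> u v; rewrite /nn_cycle_adj eq_sym; congr (_ && _).
apply: eq_existsb => s; congr (_ && _).
by rewrite -(opprB u v) eqr_opp eqr_oppLR orbC.
Qed.

Lemma nn_cycle_adj_irr : irreflexive nn_cycle_adj.
Proof. by move=> u; rewrite /nn_cycle_adj eqxx. Qed.

Definition nn_cycle := SGraph nn_cycle_adj_sym nn_cycle_adj_irr.
End NearestNeighborCycle.

Definition nn_torus (r m : nat) (k : 'I_m -> nat) :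
  sgraph {dffun forall i : 'I_m, 'Z_(k i)} :=
  box_product (fun i => nn_cycle r (k i)).

(* Algebraic multiplicities; the factorization forces size s = n and that
   every eigenvalue of A, also over an extension of F, occurs in s. *)
Definition eigenvalues_are (F : fieldType) (n : nat) (A : 'M[F]_n)
    (s : seq F) : Prop :=
  char_poly A = \prod_(a <- s) ('X - a%:P).

(* The value at j = 0 is the limit of sin ((2r+1) x) / sin x as x -> 0. *)
Definition sin_ratio (R : realType) (r k j : nat) : R :=
  if j == 0%N then (2 * r + 1)%:R
  else sin ((2 * r + 1)%:R * pi * j%:R / k%:R) / sin (pi * j%:R / k%:R).

(* Main.v *)
Require Import Defs.
From mathcomp Require Import all_boot all_order all_algebra.
From mathcomp Require Import reals trigo.
From mathcomp Require Import ring lra zify.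
Import Order.TTheory GRing.Theory Num.Theory.
Local Open Scope ring_scope.

(** The Laplacian of a graph is diagonalized over the reals by an explicit
    orthogonal family of eigenvectors.

    For one cycle with k vertices, set cas x = cos x + sin x and consider the
    Hartley vectors v |-> cas (2 pi j v / k), for 0 <= j < k: they play the role
    of the characters of Z/kZ, but are real.  The identity
    cas (x + y) + cas (x - y) = 2 cos y cas x makes each of them an eigenvector
    of every operator f |-> f (_ + s) + f (_ - s), hence of the Laplacian, which
    is a sum of such operators over s = 1, ..., r because 2r < k makes the 2r
    steps +-1, ..., +-r pairwise distinct.  The eigenvalue found in this way is
    the sum over s of 2 - 2 cos (2 pi j s / k); the Dirichlet kernel identity
    turns it into 2r + 1 minus the quotient of sines
    ([laplace_eigenbasis_nn_cycle]).  The Hartley vectors are orthogonal because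
    cas x cas y = cos (x - y) + sin (x + y), where the sines sum to zero over
    the cycle and so do the cosines, unless the two frequencies agree.

    In a box product, moving to a neighbour changes one coordinate only, so
    the products of eigenvectors of the factors are eigenvectors, with the sum
    of the eigenvalues; a sum of products over all vertices is the product of
    the sums, so orthogonality is inherited as well
    ([laplace_eigenbasis_box]).

    Finally, an orthogonal family of as many eigenvectors as there are vertices
    is an invertible matrix that conjugates the Laplacian to a diagonal matrix,
    which gives the characteristic polynomial
    ([laplace_eigenbasis_spectrum]). *)

(** * Spectrum from an orthogonal family of eigenvectors *)

(** The Laplacian as a difference operator.  In this form the degrees never
    have to be computed. *)
Definition laplace_op {R : pzRingType} {V : finType} (G : sgraph V)
  (f : V -> R) (u : V) : R := \sum_(v | G u v) (f u - f v).

(** The index type [A] of the eigenvectors is kept apart from the vertex type: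
    a cycle has vertices in Z/kZ, whereas its frequencies are natural numbers
    below k. *)
Definition laplace_eigenbasis {R : pzRingType} {V A : finType} (G : sgraph V)
    (phi : A -> V -> R) (lam : A -> R) (c : R) : Prop :=
  [/\ #|A| = #|V|, c != 0,
      forall a b, \sum_u phi a u * phi b u = c *+ (a == b)
    & forall a u, laplace_op G (phi a) u = lam a * phi a u].

Lemma char_poly_conj {F : fieldType} n (A D P : 'M[F]_n) :
  P \in unitmx -> P *m A = D *m P -> char_poly A = char_poly D.
Proof.
rewrite unitmxE unitfE => detP PA.
set Q := map_mx (@polyC F) P.
have detQ : \det Q != 0 by rewrite det_map_mx polyC_eq0.
apply: (mulfI detQ); rewrite [RHS]mulrC -!det_mulmx; congr (\det _).
by rewrite /char_poly_mx mulmxBr mulmxBl scalar_mxC -!map_mxM PA.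
Qed.

(** As the Laplacian is symmetric, multiplying it by a row vector on the left
    applies the difference operator. *)
Lemma row_mul_laplacian {R : comPzRingType} {V : finType} (G : sgraph V)
    (f : V -> R) j :
  \sum_i f (enum_val i) * laplacian R G i j = laplace_op G f (enum_val j).
Proof.
rewrite /laplace_op sumrB sumr_const.
transitivity (\sum_i (f (enum_val i) * degree_mx R G i j
              - f (enum_val i) * adjacency_mx R G i j)).
  by apply: eq_bigr => i _; rewrite !mxE mulrBr.
rewrite sumrB; congr (_ - _).
  rewrite (bigD1 j) //= big1 => [|i ij]; last by rewrite !mxE (negPf ij) mulr0.
  rewrite !mxE eqxx addr0 mulr1n mulr_natr; congr (_ *+ _).
  by rewrite /degree cardsE.
rewrite [RHS]big_mkcond [RHS](reindex _ (onW_bij _ (enum_val_bij V))) /=.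
apply: eq_bigr => i _; rewrite mxE adj_sym mulr_natr.
by case: adj.
Qed.

Lemma laplace_eigenbasis_spectrum {F : fieldType} {V A : finType}
    (G : sgraph V) (phi : A -> V -> F) lam c :
  laplace_eigenbasis G phi lam c ->
  eigenvalues_are (laplacian F G) [seq lam a | a : A].
Proof.
case=> cardA c0 orth eig.
pose e (i : 'I_#|V|) : A := enum_val (cast_ord (esym cardA) i).
have e_bij : bijective e.
  exists (fun a => cast_ord cardA (enum_rank a)) => x.
    by rewrite /e enum_valK cast_ordKV.
  by rewrite /e cast_ordK enum_rankK.
pose P : 'M[F]_#|V| := \matrix_(i, j) phi (e i) (enum_val j).
pose D : 'M[F]_#|V| := diag_mx (\row_i lam (e i)).
(* Orthogonality makes P invertible, with inverse c^-1 *: P^T. *)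
have PPt : P *m P^T = c%:M.
  apply/matrixP => i j; rewrite !mxE -(bij_eq e_bij) -orth.
  rewrite [RHS](reindex _ (onW_bij _ (enum_val_bij V))) /=.
  by apply: eq_bigr => v _; rewrite !mxE.
have PU : P \in unitmx.
  rewrite unitmxE unitfE; apply/eqP => detP0.
  have := congr1 determinant PPt; rewrite det_mulmx detP0 mul0r det_scalar.
  by move=> /eqP; rewrite eq_sym expf_eq0 (negPf c0) andbF.
have PL : P *m laplacian F G = D *m P.
  apply/matrixP => i j; rewrite mul_diag_mx !mxE -eig -row_mul_laplacian.
  by apply: eq_bigr => l _; rewrite [P i l]mxE.
rewrite /eigenvalues_are (char_poly_conj _ _ _ _ PU PL).
rewrite char_poly_trig ?diag_mx_is_trig //.
rewrite big_map big_enum /= [RHS](reindex _ (onW_bij _ e_bij)) /=.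
by apply: eq_bigr => i _; rewrite !mxE eqxx mulr1n.
Qed.

(** * Box products *)

Section Box.
Variables (I : finType) (V : I -> finType) (G : forall i, sgraph (V i)).
Local Notation vertex := {dffun forall i, V i}.

Definition set_coord (u : vertex) (p : {i : I & V i}) : vertex :=
  [ffun j => dfwith u (tagged p) j].

Lemma set_coordE (u : vertex) i (w : V i) j :
  set_coord u (Tagged V w) j = dfwith u w j.
Proof. by rewrite ffunE. Qed.

Lemma box_neighbours (u : vertex) :
  [set v | box_product G u v] =
  [set set_coord u p | p : {i & V i} & G (tag p) (u (tag p)) (tagged p)].
Proof.
apply/setP => v; rewrite inE; apply/existsP/imsetP.
  case=> i /andP[uvi /forallP uv]; exists (Tagged V (v i)).
    by rewrite inE.
  apply/ffunP => j; rewrite set_coordE; case: dfwithP => // l il.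
  by have /implyP/(_ _)/eqP-> := uv l; rewrite // eq_sym.
case=> -[i w]; rewrite inE /= => uw ->; exists i.
rewrite set_coordE dfwith_in uw; apply/forallP => j; apply/implyP => ji.
by rewrite set_coordE dfwith_out // eq_sym.
Qed.

(** Irreflexivity matters here: if [w] could be [u i], then changing no
    coordinate at all would be counted once for each factor. *)
Lemma set_coord_inj (u : vertex) :
  {in [set p : {i & V i} | G (tag p) (u (tag p)) (tagged p)] &,
   injective (set_coord u)}.
Proof.
move=> [i w] [j z]; rewrite !inE /= => uw uz e.
have := congr1 (fun f : vertex => f i) e.
rewrite !set_coordE dfwith_in.
have [ij|ij] := eqVneq j i; first by subst j; rewrite dfwith_in => ->.
by rewrite dfwith_out // => wu; rewrite wu adj_irr in uw.
Qed.

Lemma laplace_op_box {R : pzRingType} (f : vertex -> R) u :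
  laplace_op (box_product G) f u =
  \sum_i \sum_(w | G i (u i) w) (f u - f (set_coord u (Tagged V w))).
Proof.
rewrite sig_big_dep /= /laplace_op -big_set box_neighbours.
rewrite big_imset /=; last exact: set_coord_inj.
by apply: eq_big => [p|[i w] _]; rewrite ?inE.
Qed.

(** Distributivity for factors of different types; the corresponding result
    for the set-theoretic product type [fprod] is transported to finite
    functions. *)
Lemma big_dffun {R : comPzSemiRingType} (F : forall i, V i -> R) :
  \sum_(u : vertex) \prod_i F i (u i) = \prod_i \sum_x F i x.
Proof.
pose P i : {ffun V i -> R} := [ffun x => F i x].
rewrite (reindex _ (onW_bij _ (dffun_of_fprod_bij V))) /=.
transitivity (\sum_(t : fprod V) \prod_(i in I) P i (t i)).
  by apply: eq_bigr => t _; apply: eq_bigr => i _; rewrite !ffunE.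
rewrite (big_fprod _ _ P) -(bigA_distr_big_dep (tagged_with V)
  (fun i => untag 0 (P i))).
apply: eq_bigr => i _.
rewrite -(big_tag (fun i => P i)).
by apply: eq_bigr => x _; rewrite ffunE.
Qed.

End Box.

Lemma card_dffun {I : finType} (V : I -> finType) :
  #|{dffun forall i, V i}| = (\prod_i #|V i|)%N.
Proof. by rewrite card_dep_ffun foldrE big_image. Qed.

(** In the term of the Laplacian that changes coordinate i, all the factors of
    the product but the i-th one are constant and can be taken out. *)
Lemma laplace_eigenbasis_box {R : idomainType} {I : finType}
    (V A : I -> finType) (G : forall i, sgraph (V i))
    (phi : forall i, A i -> V i -> R) (lam : forall i, A i -> R) (c : I -> R) :
  (forall i, laplace_eigenbasis (G i) (phi i) (lam i) (c i)) ->
  laplace_eigenbasis (box_product G)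
    (fun (a : {dffun forall i, A i}) (u : {dffun forall i, V i}) =>
       \prod_i phi i (a i) (u i))
    (fun a : {dffun forall i, A i} => \sum_i lam i (a i)) (\prod_i c i).
Proof.
move=> basis; split.
- by rewrite !card_dffun; apply: eq_bigr => i _; case: (basis i).
- by apply/prodf_neq0 => i _; case: (basis i).
- move=> a b /=.
  under eq_bigr do rewrite -big_split /=.
  rewrite (big_dffun _ _ (fun i x => phi i (a i) x * phi i (b i) x)).
  have -> : \prod_i \sum_x phi i (a i) x * phi i (b i) x
            = \prod_i (c i *+ (a i == b i)).
    by apply: eq_bigr => i _; case: (basis i) => _ _ ->.
  have [-> | ab] := eqVneq a b.
    by apply: eq_bigr => i _; rewrite eqxx.
  (* One coordinate where the indices differ annihilates the whole product. *)
  have /existsP[i abi] : [exists i, a i != b i].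
    rewrite -negb_forall; apply: contraNN ab => /forallP ab.
    by apply/eqP/ffunP => i; apply/eqP.
  by rewrite (bigD1 i) //= (negPf abi) mul0r.
move=> a u; rewrite laplace_op_box mulr_suml; apply: eq_bigr => i _.
rewrite [in RHS](bigD1 i) //= mulrA.
case: (basis i) => _ _ _ <-; rewrite mulr_suml.
apply: eq_bigr => w _; rewrite !(bigD1 i (P := xpredT)) //=.
rewrite set_coordE dfwith_in mulrBl; congr (_ - _ * _).
by apply: eq_bigr => j ji; rewrite set_coordE dfwith_out // eq_sym.
Qed.

(** * Trigonometric sums *)

Section Trig.
Variable R : realType.
Implicit Types x y : R.

(** The sum telescopes, since
    2 sin x cos (2 s x) = sin ((2 s + 1) x) - sin ((2 s - 1) x). *)
Lemma dirichlet_kernel x n :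
  sin x * (1 + \sum_(s < n) 2 * cos ((2 * s.+1)%:R * x)) =
  sin ((2 * n + 1)%:R * x).
Proof.
elim: n => [|n IHn]; first by rewrite big_ord0 addr0 mulr1 mul1r.
rewrite big_ord_recr /= addrA mulrDr IHn.
have -> : (2 * n.+1 + 1)%:R * x = (2 * n.+1)%:R * x + x.
  by rewrite natrD; ring.
have -> : (2 * n + 1)%:R * x = (2 * n.+1)%:R * x - x.
  by rewrite natrD !natrM -natr1; ring.
by rewrite sinB sinD; ring.
Qed.

(** The kernel of the Hartley transform, a real substitute for the complex
    exponential. *)
Definition cas x : R := cos x + sin x.

Lemma casM x y : cas x * cas y = cos (x - y) + sin (x + y).
Proof. by rewrite /cas cosB sinD; ring. Qed.

(** The shift identity behind the eigenvector equation on a cycle. *)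
Lemma casDB x y : cas (x + y) + cas (x - y) = 2 * cos y * cas x.
Proof. by rewrite /cas cosD cosB sinD sinB; ring. Qed.

Lemma cas_periodic : periodic cas (pi *+ 2).
Proof. by move=> x; rewrite /cas cosD2pi sinD2pi. Qed.

Lemma sin_pi_ratio_gt0 {k j : nat} :
  (0 < j < k)%N -> 0 < sin (pi * j%:R / k%:R : R).
Proof.
case/andP=> j0 jk; have k0 : (0 : R) < k%:R by rewrite ltr0n; lia.
apply: sin_gt0_pi; apply/andP; split.
  by rewrite divr_gt0 // mulr_gt0 ?pi_gt0 // ltr0n.
by rewrite ltr_pdivrMr // ltr_pM2l ?pi_gt0 // ltr_nat.
Qed.

Definition angle (k j : nat) : R := 2 * pi * j%:R / k%:R.

Lemma angleM k j : (0 < k)%N -> angle k j * k%:R = pi *+ 2 *+ j.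
Proof.
move=> k0; rewrite /angle divfK ?pnatr_eq0 -?lt0n //; rewrite -[RHS]mulr_natr.
by rewrite -[pi *+ 2]mulr_natl.
Qed.

(** For j != 0, twice the sum is a Dirichlet kernel plus 1; the kernel equals
    sin ((2 k - 1) x) / sin x = - 1 at x = pi j / k. *)
Lemma sum_cos_angle k j : (j < k)%N ->
  \sum_(v < k) cos (angle k j * v%:R) = k%:R *+ (j == 0%N).
Proof.
case: k => // k jk; have [->|j0] := eqVneq j 0%N.
  rewrite (eq_bigr (fun=> 1)) => [|v _]; last first.
    by rewrite /angle mulr0 !mul0r cos0.
  by rewrite sumr_const card_ord.
have jk' : (0 < j < k.+1)%N by lia.
set x : R := pi * j%:R / k.+1%:R.
have ax v : angle k.+1 j * v%:R = (2 * v)%:R * x.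
  by rewrite /angle /x natrM; ring.
have sx : sin x != 0 by rewrite gt_eqF // /x sin_pi_ratio_gt0.
have kx : (2 * k + 1)%:R * x = - x + pi *+ 2 *+ j.
  rewrite -(angleM k.+1 j) // ax !natrD !natrM -natr1; ring.
have two_sx : 2 * sin x != 0 by rewrite mulf_neq0 // pnatr_eq0.
apply: (mulfI two_sx).
rewrite mulr0n mulr0 -mulrA mulrCA big_ord_recl /= mulr0 cos0.
rewrite mulrDr mulr1 mulr_sumr.
transitivity (sin x + sin x * (1 + \sum_(s < k) 2 * cos ((2 * s.+1)%:R * x))).
  under [in LHS]eq_bigr do rewrite ax.
  rewrite mulrDr; ring.
by rewrite dirichlet_kernel kx (periodicn (@sinD2pi R)) sinN subrr.
Qed.

(** The substitution v |-> k - v exchanges terms of opposite signs, and the term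
    at v = 0 vanishes. *)
Lemma sum_sin_angle k j : \sum_(v < k) sin (angle k j * v%:R) = 0.
Proof.
case: k => [|k]; first by rewrite big_ord0.
rewrite big_ord_recl mulr0 sin0 add0r.
set S := \sum_(_ < _) _; suff : S = - S by lra.
rewrite {1}/S (reindex_inj rev_ord_inj) /= -sumrN; apply: eq_bigr => v _.
rewrite -sinN /bump /= !add1n.
have -> : angle k.+1 j * (k - v.+1).+1%:R
          = - (angle k.+1 j * v.+1%:R) + pi *+ 2 *+ j.
  rewrite -(angleM k.+1 j) // -subSn // subSS natrB; last first.
    by have := ltn_ord v; lia.
  by rewrite -!natr1; ring.
by rewrite (periodicn (@sinD2pi R)).
Qed.

(** The product formula leaves cosines of frequency a - b and sines of frequency
    a + b. *)
Lemma sum_cas_angle k a b : (a < k)%N -> (b < k)%N ->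
  \sum_(v < k) cas (angle k a * v%:R) * cas (angle k b * v%:R)
  = k%:R *+ (a == b).
Proof.
wlog ba : a b / (b <= a)%N => [hw|ak bk].
  have [/hw//|/ltnW ab ak bk] := leqP b a.
  by rewrite eq_sym -hw //; apply: eq_bigr => v _; rewrite mulrC.
have -> : (a == b) = (a - b == 0)%N by lia.
transitivity (\sum_(v < k) cos (angle k (a - b) * v%:R)
              + \sum_(v < k) sin (angle k (a + b) * v%:R)); last first.
  by rewrite sum_cos_angle ?sum_sin_angle ?addr0 //; lia.
rewrite -big_split /=.
apply: eq_bigr => v _; rewrite casM; congr (cos _ + sin _).
  by rewrite /angle natrB //; ring.
by rewrite /angle natrD; ring.
Qed.

End Trig.

(** * Nearest neighbor cycles *)

Section Cycle.
(* The cycle has k.+2 vertices, so that 'Z_k.+2 is convertible to 'I_k.+2. *)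
Variables (R : realType) (r k : nat).
Hypothesis hk : (2 * r < k.+2)%N.

Definition signed_step (p : bool * 'I_r) : 'Z_k.+2 :=
  if p.1 then p.2.+1%:R else - p.2.+1%:R.

Lemma val_natr_Zp n : (n%:R : 'Z_k.+2) = (n %% k.+2)%N :> nat.
Proof. by rewrite Zp_nat. Qed.

Lemma natr_Zp_inj m n : (m < k.+2)%N -> (n < k.+2)%N ->
  m%:R = n%:R :> 'Z_k.+2 -> m = n.
Proof.
move=> mk nk /(congr1 (fun x : 'Z_k.+2 => x : nat)).
by rewrite !val_natr_Zp !modn_small.
Qed.

Lemma nn_cycle_neighbours (u : 'Z_k.+2) :
  [set v | nn_cycle r k.+2 u v] = [set u + signed_step p | p : bool * 'I_r].
Proof.
apply/setP => v; rewrite inE; apply/idP/imsetP.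
  case/andP=> _ /existsP[[s sr] /= /andP[s0 vu]].
  have sr' : (s.-1 < r)%N by lia.
  exists (v - u == s%:R, Ordinal sr') => //.
  rewrite /signed_step /= prednK //.
  by case: eqP vu => /= [<- _|_ /eqP <-]; rewrite addrC subrK.
case=> -[b s] _ ->; have sr := ltn_ord s.
have vu : u + signed_step (b, s) - u = signed_step (b, s).
  by rewrite addrC addKr.
apply/andP; split.
  rewrite eq_sym -subr_eq0 vu /signed_step.
  have s0 : s.+1%:R != 0 :> 'Z_k.+2.
    by apply/eqP => /(natr_Zp_inj s.+1 0); lia.
  by case: b {vu}; rewrite /= ?oppr_eq0.
apply/existsP; exists (lift ord0 s); rewrite vu /signed_step /= /bump add1n.
by case: b {vu}; rewrite /= eqxx ?orbT.
Qed.

(** Two steps of opposite signs differ by at least 2 and at most 2r < k. *)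
Lemma signed_step_inj : injective signed_step.
Proof.
have N0 s t : (s < r)%N -> (t < r)%N -> s.+1%:R = - t.+1%:R :> 'Z_k.+2 -> False.
  move=> sr tr /eqP; rewrite -subr_eq0 opprK -natrD => /eqP.
  by move=> /(natr_Zp_inj _ 0); lia.
have inj (s t : 'I_r) : s.+1%:R = t.+1%:R :> 'Z_k.+2 -> s = t.
  have := ltn_ord s; have := ltn_ord t => ? ?.
  by move=> /natr_Zp_inj st; apply/val_inj => /=; lia.
move=> [[] s] [[] t]; rewrite /signed_step /= => e.
- by rewrite (inj s t).
- by case: (N0 s t).
- by case: (N0 t s).
- by rewrite (inj s t) //; apply: oppr_inj.
Qed.

Lemma laplace_op_nn_cycle (f : 'Z_k.+2 -> R) u :
  laplace_op (nn_cycle r k.+2) f u =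
  \sum_(s < r) (2 * f u - (f (u + s.+1%:R) + f (u - s.+1%:R))).
Proof.
rewrite /laplace_op -big_set nn_cycle_neighbours big_imset /=; last first.
  by move=> p q _ _ /addrI/signed_step_inj.
rewrite -(pair_big xpredT xpredT
  (fun b s => f u - f (u + signed_step (b, s)))) /=.
by rewrite big_bool -big_split; apply: eq_bigr => s _ /=; ring.
Qed.

Definition hartley (j : 'I_k.+2) (v : 'Z_k.+2) : R :=
  cas R (angle R k.+2 j * (v : nat)%:R).

(** Reduction modulo the length of the cycle changes the angle by a multiple of
    2 pi.  The free phase [y] lets the same lemma serve for both v + n and
    v - n. *)
Lemma cas_angle_Zp (j n : nat) (v : 'Z_k.+2) y :
  cas R (angle R k.+2 j * ((v + n%:R)%R : nat)%:R + y) =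
  cas R (angle R k.+2 j * ((v : nat)%:R + n%:R) + y).
Proof.
have -> : ((v + n%:R)%R : nat) = ((v + n) %% k.+2)%N.
  by rewrite /= val_natr_Zp modnDmr.
rewrite -natrD [in RHS](divn_eq (v + n) k.+2) natrD natrM.
set q := (_ %/ _)%N; set m := (_ %% _)%N.
have -> : angle R k.+2 j * (q%:R * k.+2%:R + m%:R) + y
    = (angle R k.+2 j * m%:R + y) + pi *+ 2 *+ (j * q).
  by rewrite mulrnA -(angleM R k.+2 j) // -mulr_natr; ring.
by rewrite (periodicn (cas_periodic R)).
Qed.

Lemma hartley_shift (j : 'I_k.+2) (v : 'Z_k.+2) (n : nat) :
  hartley j (v + n%:R) + hartley j (v - n%:R) =
  2 * cos (angle R k.+2 j * n%:R) * hartley j v.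
Proof.
rewrite -casDB; congr (_ + _).
  by have := cas_angle_Zp j n v 0; rewrite !addr0 -mulrDr.
(* v is (v - n) + n, and the phase takes the second n back. *)
have := cas_angle_Zp j n (v - n%:R) (- (angle R k.+2 j * n%:R)).
by rewrite subrK => ->; rewrite /hartley mulrDr addrK.
Qed.

(** The Dirichlet kernel at x = pi j / k; for j = 0 all the terms on the left
    vanish, which matches the limiting value 2r + 1 of the quotient. *)
Lemma nn_cycle_eigenvalue (j : 'I_k.+2) :
  \sum_(s < r) (2 - 2 * cos (angle R k.+2 j * s.+1%:R)) =
  (2 * r + 1)%:R - sin_ratio R r k.+2 j.
Proof.
rewrite sumrB sumr_const card_ord /sin_ratio.
have -> : 2 *+ r = (2 * r)%:R :> R by rewrite natrM mulr_natr.
set S := \sum_(_ < _) _.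
suff <- : 1 + S = if j == 0%N :> nat then (2 * r + 1)%:R
  else sin ((2 * r + 1)%:R * pi * j%:R / k.+2%:R) / sin (pi * j%:R / k.+2%:R).
  by rewrite natrD; ring.
have [j0|j0] := eqVneq (j : nat) 0%N.
  rewrite /S (eq_bigr (fun=> 2)) => [|s _].
    by rewrite sumr_const card_ord natrD natrM mulr_natr addrC.
  by rewrite j0 /angle mulr0 !mul0r cos0 mulr1.
have sx : sin (pi * j%:R / k.+2%:R : R) != 0.
  by rewrite gt_eqF // sin_pi_ratio_gt0 // lt0n j0 ltn_ord.
set x : R := pi * j%:R / k.+2%:R in sx *.
apply: (mulfI sx); rewrite mulrC [RHS]mulrC divfK // mulrC.
have -> : (2 * r + 1)%:R * pi * j%:R / k.+2%:R = (2 * r + 1)%:R * x.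
  by rewrite /x; ring.
rewrite -dirichlet_kernel; congr (_ * (_ + _)); apply: eq_bigr => s _.
by congr (_ * cos _); rewrite /angle /x natrM; ring.
Qed.

End Cycle.

Lemma laplace_eigenbasis_nn_cycle (R : realType) (r k : nat) :
  (0 < r)%N -> (2 * r < k)%N ->
  exists phi : 'I_k -> 'Z_k -> R,
  laplace_eigenbasis (nn_cycle r k) phi
    (fun j => (2 * r + 1)%:R - sin_ratio R r k j) k%:R.
Proof.
case: k => [|[|k]] r0 hk; [lia|lia|].
exists (hartley R k); split.
- by rewrite !card_ord.
- by rewrite pnatr_eq0.
- by move=> a b; apply: sum_cas_angle.
move=> j u; rewrite laplace_op_nn_cycle // -nn_cycle_eigenvalue mulr_suml.
by apply: eq_bigr => s _; rewrite hartley_shift mulrBl.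
Qed.

Theorem theorem5 (R : realType) (m r : nat) (k : 'I_m -> nat)
  (hm : (1 <= m)%N) (hr : (1 <= r)%N) (hk : forall i : 'I_m, (2 * r < k i)%N) :
  eigenvalues_are (laplacian R (nn_torus r k))
    [seq ((2 * r + 1) * m)%:R - \sum_(i < m) sin_ratio R r (k i) (j i)
       | j : {dffun forall i : 'I_m, 'I_(k i)}].
Proof.
have /fin_all_exists[phi basis] i :=
  laplace_eigenbasis_nn_cycle R r (k i) hr (hk i).
have := laplace_eigenbasis_spectrum _ _ _ _
  (laplace_eigenbasis_box _ _ _ _ _ _ basis).
rewrite /eigenvalues_are => ->; rewrite !big_map.
apply: eq_bigr => j _; congr ('X - _%:P).
by rewrite sumrB sumr_const card_ord natrM mulr_natr.
Qed.
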